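(* (Wendroff's Theorem for second kind POPUC.) Let $n\ge 1$. Let $\alpha_0,\dots,\alpha_{n-1}\in\mathbb{D}$ and $\lambda\in\partial\mathbb{D}$; let $\{w_j\}_{j=1}^{n+1}$ be the zeros of the POPUC $\Phi_{n+1}(z;\lambda)$, ordered clockwise, and let $\{y_j\}_{j=1}^{n+1}$ be the zeros of the associated second kind POPUC $\Psi_{n+1}(z;\lambda)$, also ordered clockwise, with $y_1$ the first zero after $w_1$ going clockwise. Then the $w$'s and $y$'s strictly interlace and $$\prod_{j=1}^{n+1}y_j=-\prod_{j=1}^{n+1}w_j.\qquad(\dagger)$$ Conversely, if $\{w_j\}_{j=1}^{n+1}$ and $\{y_j\}_{j=1}^{n+1}$ are strictly interlacing sets of points on $\partial\mathbb{D}$ obeying $(\dagger)$, then there are unique $\alpha_0,\dots,\alpha_{n-1}\in\mathbb{D}$ and $\lambda\in\partial\mathbb{D}$ such that $\{w_j\}_{j=1}^{n+1}$ is the set of zeros of the associated POPUC $\Phi_{n+1}(z;\lambda)$ and $\{y_j\}_{j=1}^{n+1}$ is the set of zeros of the associated second kind POPUC $\Psi_{n+1}(z;\lambda)$.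
   Context: $\mathbb{D}$ is the open unit disk. For a polynomial $P$ regarded as having degree $k$, $P^*(z)=z^k\overline{P(1/\bar z)}$. Given $\alpha_0,\dots,\alpha_{n-1}\in\mathbb{D}$ (Verblunsky coefficients), define monic polynomials by $\Phi_0=1$ and $\Phi_{j+1}(z)=z\Phi_j(z)-\overline{\alpha_j}\,\Phi_j^*(z)$, $0\le j\le n-1$. For $\lambda\in\partial\mathbb{D}$, the POPUC is $\Phi_{n+1}(z;\lambda)=z\Phi_n(z)-\bar\lambda\,\Phi_n^*(z)$. The second kind polynomials are obtained by changing the sign of all Verblunsky coefficients: $\Psi_0=1$, $\Psi_{j+1}(z)=z\Psi_j(z)+\overline{\alpha_j}\,\Psi_j^*(z)$, $0\le j\le n-1$; the second kind POPUC also changes the sign of $\lambda$: $\Psi_{n+1}(z;\lambda)=z\Psi_n(z)+\bar\lambda\,\Psi_n^*(z)$. Both POPUCs have $n+1$ distinct zeros, all on $\partial\mathbb{D}$. Two sets of $n+1$ distinct points on $\partial\mathbb{D}$ strictly interlace if they are disjoint and each of the $n+1$ open arcs of $\partial\mathbb{D}$ obtained by removing one set contains exactly one point of the other set. *)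

(* Defs.v *)
(* The complex numbers are R[i] over an abstract R : realType. *)
From HB Require Import structures.
From mathcomp Require Import all_boot all_order all_algebra.
From mathcomp Require Import complex.
From mathcomp Require Import boolp classical_sets reals trigo.

Set Implicit Arguments.
Unset Strict Implicit.
Unset Printing Implicit Defensive.

Import Order.TTheory GRing.Theory Num.Theory.
Local Open Scope classical_set_scope.
Local Open Scope ring_scope.

(* P regarded as having degree k: coefficients are conjugated and reversed.
   [reversed_hornerE] is the formula z^k * conj (P (1 / conj z)). *)
Definition reversed (C : numClosedFieldType) (k : nat) (P : {poly C}) :
    {poly C} :=
  \poly_(i < k.+1) (P`_(k - i))^*.

Lemma reversed_hornerE (C : numClosedFieldType) (k : nat) (P : {poly C})
    (z : C) :
  (size P <= k.+1)%N -> z != 0 ->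
  (reversed k P).[z] = z ^+ k * (P.[(z^*)^-1])^*.
Proof.
move=> szP z0; rewrite horner_poly (horner_coef_wide _ szP).
rewrite rmorph_sum mulr_sumr (reindex_inj rev_ord_inj) /=.
apply: eq_bigr => i _; have ik : (i <= k)%N by rewrite -ltnS.
rewrite subSS subKn // rmorphM /= rmorphXn /= fmorphV /= conjCK mulrCA.
by congr (_ * _); rewrite exprVn expfB_cond // (negPf z0) add0n.
Qed.

Fixpoint Phi (C : numClosedFieldType) (a : seq C) (j : nat) : {poly C} :=
  if j is k.+1 then 'X * Phi a k - (a`_k)^* *: reversed k (Phi a k) else 1.

Definition POPUC (C : numClosedFieldType) (n : nat) (a : seq C) (lam : C) :
    {poly C} :=
  'X * Phi a n - lam^* *: reversed n (Phi a n).

Definition second_kind_POPUC (C : numClosedFieldType) (n : nat) (a : seq C)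
    (lam : C) : {poly C} :=
  POPUC n [seq - x | x <- a] (- lam).

Definition zeros (C : numClosedFieldType) (P : {poly C}) : set C :=
  [set z | root P z].

Definition expi (R : realType) (t : R) : R[i] := Complex (cos t) (sin t).

(* The open arc of the unit circle run through when going clockwise from a
   to b; for a = b it is the circle with a removed. *)
Definition clockwise_arc (R : realType) (a b : R[i]) : set R[i] :=
  [set z | exists s t u : R, [/\ a = expi s, b = expi t, z = expi u,
                                 t < u < s & s <= t + 2 * pi]].

Definition clockwise_ordered (R : realType) (m : nat) (w : 'I_m -> R[i]) :
    Prop :=
  exists theta : 'I_m -> R,
    [/\ forall j, w j = expi (theta j),
        forall j k : 'I_m, (j < k)%N -> theta k < theta j &
        forall j k : 'I_m, theta j < theta k + 2 * pi].

(* For a finite subset A of the circle, the components of the circle minus A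
   are the arcs with endpoints in A that do not meet A. *)
Definition one_in_each_arc (R : realType) (A B : set R[i]) : Prop :=
  forall a b, A a -> A b -> clockwise_arc a b `&` A = set0 ->
    exists! z, B z /\ clockwise_arc a b z.

Definition strictly_interlace (R : realType) (m : nat) (w y : 'I_m -> R[i]) :
    Prop :=
  [/\ injective w /\ injective y,
      forall j, `|w j| = 1 /\ `|y j| = 1,
      range w `&` range y = set0,
      one_in_each_arc (range w) (range y) &
      one_in_each_arc (range y) (range w)].

Definition zero_labelling (R : realType) (n : nat) (a : seq R[i])
    (lam : R[i]) (w y : 'I_n.+1 -> R[i]) : Prop :=
  [/\ zeros (POPUC n a lam) = range w /\ clockwise_ordered w,
      zeros (second_kind_POPUC n a lam) = range y /\ clockwise_ordered y &
      forall k, ~ clockwise_arc (w ord0) (y ord0) (y k)].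

(* Main.v *)
(* Reversing the order of the transfer matrices shows that the POPUC of
   (alpha, lambda) and its second kind POPUC are z A - conj(lambda) A^* and
   z A + conj(lambda) A^*, where A is the degree n polynomial Phi_n with
   Verblunsky coefficients b_k = - lambda conj(alpha_(n-1-k)). Hence both sets
   of zeros are level sets of the argument of the Blaschke product z A / A^*,
   which is strictly increasing along the circle and winds n+1 times: they
   interlace, and the products of the zeros are read off at z = 0.
   Conversely, let P and Q be the monic polynomials vanishing at the w's and at
   the y's. Interlacing and the product condition make Q / P a convex
   combination of the functions (z + w_j) / (z - w_j), so P + Q = 2 z A has no
   zero with |z| >= 1; the inverse Szego recursion then
   writes A as Phi_n with unique Verblunsky coefficients in the disk, and
   z A -+ conj(lambda) A^* = P, Q because P and Q are self-reciprocal up to a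
   constant. *)
Require Import Defs.
From HB Require Import structures.
From mathcomp Require Import all_boot all_order all_algebra.
From mathcomp Require Import zify ring lra.
From mathcomp Require Import complex.
From mathcomp Require Import boolp classical_sets reals topology.
From mathcomp Require Import normedtype derive realfun trigo.

Set Implicit Arguments.
Unset Strict Implicit.
Unset Printing Implicit Defensive.

Import Order.TTheory GRing.Theory Num.Theory numFieldNormedType.Exports.
Local Open Scope classical_set_scope.
Local Open Scope ring_scope.

(** * Szego recursion *)

Section Szego.
Variable C : numClosedFieldType.
Implicit Types (P Q A : {poly C}) (a b : seq C) (l z : C) (k n : nat).

Lemma coef_reversed k P i :
  (reversed k P)`_i = if (i <= k)%N then (P`_(k - i))^* else 0.
Proof. by rewrite coef_poly ltnS. Qed.

Lemma size_reversed k P : (size (reversed k P) <= k.+1)%N.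
Proof. exact: size_poly. Qed.

Lemma reversedD k P Q : reversed k (P + Q) = reversed k P + reversed k Q.
Proof.
apply/polyP => i; rewrite coefD !coef_reversed.
by case: ifP; rewrite ?addr0 // coefD rmorphD.
Qed.

Lemma reversedZ k l P : reversed k (l *: P) = l^* *: reversed k P.
Proof.
apply/polyP => i; rewrite coefZ !coef_reversed.
by case: ifP; rewrite ?mulr0 // coefZ rmorphM.
Qed.

Lemma reversedB k P Q : reversed k (P - Q) = reversed k P - reversed k Q.
Proof.
by rewrite -(scaleN1r Q) reversedD reversedZ rmorphN1 scaleN1r.
Qed.

Lemma reversedK k P : (size P <= k.+1)%N -> reversed k (reversed k P) = P.
Proof.
move=> sP; apply/polyP => i; rewrite !coef_reversed leq_subr.
case: leqP => [ik|ki]; first by rewrite subKn // conjCK.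
by rewrite nth_default // (leq_trans sP).
Qed.

Lemma reversedXM k P : reversed k.+1 ('X * P) = reversed k P.
Proof.
apply/polyP => i; rewrite !coef_reversed coefXM.
case: (ltngtP i k.+1) => [ik|ik|->]; last 1 first.
- by rewrite subnn eqxx conjC0 ltnn.
- by rewrite ltnS in ik; rewrite ik subSn.
- by rewrite leqNgt (ltnW ik).
Qed.

Lemma reversedSS k P :
  (size P <= k.+1)%N -> reversed k.+1 P = 'X * reversed k P.
Proof.
move=> sP; rewrite -{1}(reversedK sP) -(reversedXM k (reversed k P)) reversedK //.
apply: leq_trans (size_polyMleq _ _) _; rewrite size_polyX ltnS.
exact: size_reversed.
Qed.

Lemma horner0_reversed k P : (reversed k P).[0] = (P`_k)^*.
Proof. by rewrite horner_coef0 coef_reversed subn0. Qed.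

Lemma reversed01 : reversed 0 (1 : {poly C}) = 1.
Proof.
apply/polyP => i; rewrite coef_reversed !coef1 leqn0.
by case: eqP => // _; rewrite conjC1.
Qed.

Lemma PhiS a k :
  Phi a k.+1 = 'X * Phi a k - (a`_k)^* *: reversed k (Phi a k).
Proof. by []. Qed.

Lemma Phi_eq a b k : (forall i, (i < k)%N -> a`_i = b`_i) -> Phi a k = Phi b k.
Proof.
elim: k => // k IH ab; rewrite !PhiS ab // IH // => i ik.
exact/ab/(ltn_trans ik).
Qed.

Lemma monic_lincomb k l P : P \is monic -> size P = k.+1 ->
  'X * P - l *: reversed k P \is monic /\
  size ('X * P - l *: reversed k P) = k.+2.
Proof.
move=> mP sP.
have sXP : size ('X * P) = k.+2 by rewrite mulrC size_mulX -?size_poly_eq0 sP.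
have lt : (size (- (l *: reversed k P)) < size ('X * P)%R)%N.
  rewrite size_polyN sXP ltnS.
  exact: leq_trans (size_scale_leq _ _) (size_reversed _ _).
split; last by rewrite size_polyDl.
by rewrite monicE lead_coefDl // mulrC lead_coefMX -monicE.
Qed.

Lemma Phi_monic_size a k : Phi a k \is monic /\ size (Phi a k) = k.+1.
Proof.
elim: k => [|k [mP sP]]; first by rewrite monic1 size_poly1.
exact: monic_lincomb.
Qed.

Lemma Phi_monic a k : Phi a k \is monic.
Proof. by have [] := Phi_monic_size a k. Qed.

Lemma size_Phi a k : size (Phi a k) = k.+1.
Proof. by have [] := Phi_monic_size a k. Qed.

Lemma POPUC_monic n a l : POPUC n a l \is monic.
Proof. by have [] := monic_lincomb l^* (Phi_monic a n) (size_Phi a n). Qed.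

Lemma size_POPUC n a l : size (POPUC n a l) = n.+2.
Proof. by have [] := monic_lincomb l^* (Phi_monic a n) (size_Phi a n). Qed.

Lemma monic_coef k P : P \is monic -> size P = k.+1 -> P`_k = 1.
Proof. by move=> /monicP <- sP; rewrite lead_coefE sP. Qed.

(** The reversal of a monic polynomial is 1 at the origin, so the multiplier [l] is read off there:
    the last Verblunsky coefficient, or the parameter of a POPUC. *)
Lemma horner0_lincomb k l P : P \is monic -> size P = k.+1 ->
  ('X * P - l *: reversed k P).[0] = - l.
Proof.
move=> mP sP; rewrite hornerD hornerM hornerX mul0r add0r hornerN hornerZ.
by rewrite horner0_reversed (monic_coef mP sP) conjC1 mulr1.
Qed.

Lemma horner0_POPUC n a l : (POPUC n a l).[0] = - l^*.
Proof. exact: horner0_lincomb (Phi_monic a n) (size_Phi a n). Qed.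

Lemma reversed_PhiS a k :
  reversed k.+1 (Phi a k.+1) =
  reversed k (Phi a k) - a`_k *: ('X * Phi a k).
Proof.
rewrite PhiS reversedB reversedXM reversedZ conjCK.
by rewrite reversedSS ?size_reversed // reversedK // size_Phi.
Qed.

(** Adding a multiple of the reversed recursion eliminates Phi_k^* and isolates Phi_k, so the
    recursion can be run backwards when |a_k| < 1. *)
Lemma inverse_szego a k :
  Phi a k.+1 + (a`_k)^* *: reversed k.+1 (Phi a k.+1) =
  (1 - `|a`_k| ^+ 2) *: ('X * Phi a k).
Proof.
rewrite reversed_PhiS PhiS scalerBr scalerA normCKC scalerBl scale1r.
ring.
Qed.

(** * Reversing the order of the transfer matrices *)

Definition dual l a : seq C := [seq - l * x^* | x <- rev a].

Lemma nth_dual l a i : (i < size a)%N ->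
  (dual l a)`_i = - l * (a`_(size a - i.+1))^*.
Proof. by move=> ia; rewrite (nth_map 0) ?size_rev // nth_rev. Qed.

Lemma size_dual l a : size (dual l a) = size a.
Proof. by rewrite size_map size_rev. Qed.

(** Each entry is multiplied by l conj(l) = 1. Through this involution, coefficients found on the
    reversed side return to the original one. *)
Lemma dualK l a : `|l| = 1 -> dual l (dual l a) = a.
Proof.
move=> l1; rewrite /dual -map_rev revK -map_comp map_id_in // => x _ /=.
by rewrite rmorphM rmorphN /= conjCK mulrA mulrNN -normCK l1 expr1n mul1r.
Qed.

Lemma dual_lt1 l a : `|l| = 1 -> (forall x, x \in a -> `|x| < 1) ->
  forall x, x \in dual l a -> `|x| < 1.
Proof.
move=> l1 a1 _ /mapP[x xa ->]; rewrite normrM normrN l1 mul1r norm_conjC.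
by apply: a1; rewrite mem_rev in xa.
Qed.

(* The row vector (z, - conj l) times the last k transfer matrices is
   (z A_k, - conj l * A_k^* ), where A_k = Phi (dual l a) k. *)
Lemma POPUC_dual a l : `|l| = 1 ->
  POPUC (size a) a l = POPUC (size a) (dual l a) l.
Proof.
move=> l1; set n := size a.
(* At k = 0 this is the POPUC of [a], at k = n that of [dual l a]; each step absorbs one transfer
   matrix into the row vector. *)
suff H k : (k <= n)%N ->
    POPUC n a l = 'X * Phi (dual l a) k * Phi a (n - k)
      - l^* *: (reversed k (Phi (dual l a) k) * reversed (n - k) (Phi a (n - k))).
  by rewrite (H n) // subnn /= reversed01 !mulr1.
elim: k => [_|k IH kn].
  by rewrite subn0 /= reversed01 mulr1 mul1r.
rewrite IH; last exact: ltnW.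
have -> : (n - k = (n - k.+1).+1)%N by rewrite subnSK.
rewrite !reversed_PhiS !PhiS (nth_dual l kn).
have ll : l * l^* = 1 by rewrite -normCK l1 expr1n.
rewrite !rmorphM !rmorphN /= conjCK.
rewrite -!mul_polyC !rmorphM !rmorphN /=.
have llP : l%:P * (l^*)%:P = 1 :> {poly C} by rewrite -rmorphM /= ll.
set j := (n - k.+1)%N.
move: (l%:P) (l^*%:P) llP => L L' LL.
move: (Phi _ k) (Phi a j) (reversed k _) (reversed j _) => U V U' V'.
move: ((a`_j)^*%:P) ((a`_j)%:P) => x' x.
apply/subr0_eq.
(* The two sides agree only modulo l conj(l) = 1; this is their exact difference. *)
transitivity ((L * L' - 1) * 'X * U * V' * x'); last by rewrite LL subrr !mul0r.
ring.
Qed.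

(** Negating [a] and [l] together leaves the products - l conj(a_k) unchanged, so both kinds share
    one dual sequence and differ in the sign of the parameter. *)
Lemma second_kind_dual a l : `|l| = 1 ->
  second_kind_POPUC (size a) a l = POPUC (size a) (dual l a) (- l).
Proof.
move=> l1; rewrite /second_kind_POPUC.
rewrite -[size a](size_map -%R) POPUC_dual ?normrN //; congr POPUC.
rewrite /dual -map_rev -map_comp; apply: eq_map => x /=.
by rewrite rmorphN /= mulrNN.
Qed.

(** The value at 0 gives the last coefficient; as 1 - |a_n|^2 is nonzero, [inverse_szego] then
    determines Phi_n, and the induction descends. *)
Lemma Phi_inj a b n :
  (forall i, (i < n)%N -> `|a`_i| < 1) -> Phi a n = Phi b n ->
  forall i, (i < n)%N -> a`_i = b`_i.
Proof.
elim: n => // n IH a1 ab.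
have ab0 : a`_n = b`_n.
  apply: (can_inj (@conjCK C)); apply: oppr_inj.
  rewrite -(horner0_lincomb (a`_n)^* (Phi_monic a n) (size_Phi a n)).
  rewrite -(horner0_lincomb (b`_n)^* (Phi_monic b n) (size_Phi b n)).
  exact: (congr1 (horner^~ 0) ab).
have ne : 1 - `|a`_n| ^+ 2 != 0.
  by rewrite subr_eq0 eq_sym lt_eqF // expr_lt1 // a1.
have abn : Phi a n = Phi b n.
  apply: (mulfI (negbT (polyX_eq0 C))); apply: (scalerI ne).
  by rewrite -inverse_szego ab0 -inverse_szego ab.
move=> i; rewrite ltnS leq_eqVlt => /orP[/eqP -> //|].
by apply: IH => // j jn; apply/a1/(ltn_trans jn).
Qed.

(** The pointwise formula for [reversed] holds off the origin, so identities are tested there; 1, 2,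
    3, ... supply more zeros of P - Q than its degree allows. *)
Lemma poly_eq_neq0 P Q : (forall z, z != 0 -> P.[z] = Q.[z]) -> P = Q.
Proof.
move=> PQ; apply/eqP; rewrite -subr_eq0; apply/eqP.
apply: (@roots_geq_poly_eq0 _ _ [seq i.+1%:R | i <- iota 0 (size (P - Q))]).
- apply/allP => _ /mapP[i _ ->]; rewrite rootE hornerD hornerN PQ ?subrr //.
  by rewrite pnatr_eq0.
- rewrite map_inj_uniq ?iota_uniq // => i j /eqP.
  by rewrite eqr_nat eqSS => /eqP.
- by rewrite size_map size_iota.
Qed.

(** * Polynomials with all zeros in the open disk, and the inverse recursion *)

Definition disk_zeros P := forall z, 1 <= `|z| -> P.[z] != 0.

(** Zero by zero: |z - x|^2 - |1 - z conj(x)|^2 = (|z|^2 - 1)(1 - |x|^2) is nonnegative for |x| < 1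
    <= |z|. *)
Lemma disk_zeros_reversed n P : P \is monic -> size P = n.+1 ->
  disk_zeros P -> forall z, 1 <= `|z| -> `|(reversed n P).[z]| <= `|P.[z]|.
Proof.
move=> mP sP dP z z1.
have z0 : z != 0 by rewrite -normr_gt0 (lt_le_trans ltr01).
have [r Pr] := closed_field_poly_normal P.
rewrite (monicP mP) scale1r in Pr.
have sr : size r = n.
  by apply/succn_inj; rewrite -sP Pr size_prod_XsubC.
rewrite reversed_hornerE ?sP //.
have -> : z ^+ n = \prod_(x <- r) z.
  by rewrite big_const_seq count_predT sr iter_mulr_1.
rewrite Pr !horner_prod rmorph_prod /=.
rewrite -big_split /= !normr_prod big_seq [leRHS]big_seq.
apply: ler_prod => x xr; rewrite normr_ge0 /= !hornerXsubC.
have x1 : `|x| < 1.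
  rewrite real_ltNge ?normr_real //; apply/negP => /dP.
  by rewrite Pr -rootE root_prod_XsubC xr.
rewrite rmorphB fmorphV /= conjCK mulrBr divff //.
rewrite -(@ler_pXn2r _ 2) ?nnegrE // !normCK.
rewrite -subr_ge0 !rmorphB rmorphM rmorph1 /= conjCK.
have -> : (z - x) * (z^* - x^*) - (1 - z * x^*) * (1 - z^* * x) =
  (z * z^* - 1) * (1 - x * x^*) by ring.
rewrite -!normCK mulr_ge0 // subr_ge0 ?expr_ge1 ?expr_le1 //.
exact: ltW.
Qed.

(** Up to sign this is the product of the zeros; the degree is at least one, and one factor split
    off makes the bound strict. *)
Lemma disk_zeros_horner0 n P : P \is monic -> size P = n.+2 ->
  disk_zeros P -> `|P.[0]| < 1.
Proof.
move=> mP sP dP; have [r Pr] := closed_field_poly_normal P.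
rewrite (monicP mP) scale1r in Pr.
have sr : size r = n.+1.
  by apply/succn_inj; rewrite -sP Pr size_prod_XsubC.
have x1 x : x \in r -> `|x| < 1.
  move=> xr; rewrite real_ltNge ?normr_real //; apply/negP => /dP.
  by rewrite Pr -rootE root_prod_XsubC xr.
rewrite Pr horner_prod normr_prod.
case: r sr x1 {Pr} => //= x r _ x1; rewrite big_cons hornerXsubC sub0r normrN.
apply: (@le_lt_trans _ _ `|x|); last by rewrite x1 ?mem_head.
rewrite ler_piMr // big_seq prodr_ile1 // => y yr.
by rewrite normr_ge0 hornerXsubC sub0r normrN ltW // x1 // inE yr orbT.
Qed.

(** Peels off one coefficient at a time: with c = -P(0), P + c P^* vanishes at 0, and its normalized
    quotient by z is again monic with zeros in the disk. *)
Lemma Phi_surj n P : P \is monic -> size P = n.+1 -> disk_zeros P ->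
  exists b : seq C, [/\ size b = n, forall x, x \in b -> `|x| < 1 &
    Phi b n = P].
Proof.
elim: n P => [|n IH] P mP sP dP.
  exists [::]; split => //=; apply/esym.
  by rewrite (size1_polyC (eq_leq sP)) (monic_coef mP sP).
have c1 : `|P.[0]| < 1 by exact: disk_zeros_horner0 mP sP dP.
set c := - P.[0]; rewrite -normrN -/c in c1.
set d := 1 - `|c| ^+ 2.
have d0 : d != 0 by rewrite subr_eq0 eq_sym lt_eqF // expr_lt1.
have dR : d^* = d by rewrite rmorphB rmorph1 rmorphXn /= conj_normC.
have [D PD] : exists D, P + c *: reversed n.+1 P = d *: ('X * D).
  have : root (P + c *: reversed n.+1 P) 0.
    rewrite rootE hornerD hornerZ horner0_reversed (monic_coef mP sP).
    by rewrite conjC1 mulr1 subrr.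
  move=> /factor_theorem[D]; rewrite subr0 => ->.
  by exists (d^-1 *: D); rewrite -scalerAr scalerA divff // scale1r mulrC.
have XD : 'X * D = d^-1 *: (P + c *: reversed n.+1 P).
  by rewrite PD scalerA mulVf // scale1r.
have Dco i : D`_i = d^-1 * (P`_i.+1 + c * (reversed n.+1 P)`_i.+1).
  by rewrite -coefZ -coefD -coefZ -XD coefXM.
have szD' : (size D <= n.+1)%N.
  apply/leq_sizeP => i ni; rewrite Dco coef_reversed ltnNge ni /=.
  by rewrite nth_default ?sP // mulr0 addr0 mulr0.
have nD : D`_n = 1.
  rewrite Dco (monic_coef mP sP) coef_reversed leqnn subnn -horner_coef0.
  have -> : P.[0] = - c by rewrite opprK.
  by rewrite rmorphN mulrN -normCK mulVf.
have szD : size D = n.+1.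
  apply/eqP; rewrite eqn_leq szD' ltnNge; apply/negP => /leq_sizeP/(_ n (leqnn _)).
  by move/eqP; rewrite nD oner_eq0.
have mD : D \is monic by rewrite monicE lead_coefE szD nD.
(* A zero with |z| >= 1 would give P = -c P^* there with |c| < 1, against |P^*| <= |P| and P
   nonzero. *)
have dD : disk_zeros D.
  move=> z z1; apply/negP => /eqP Dz.
  have := dP _ z1; rewrite -normr_eq0 => /eqP; apply.
  have /eqP : P.[z] + c * (reversed n.+1 P).[z] = 0.
    by rewrite -hornerZ -hornerD PD hornerZ hornerM Dz !mulr0.
  rewrite addr_eq0 => /eqP Pz.
  have := disk_zeros_reversed mP sP dP z1.
  apply: contraTeq => Pz0; rewrite -real_ltNge ?normr_real //.
  rewrite {1}Pz normrN normrM gtr_pMl //.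
  rewrite normr_gt0; apply: contraNneq Pz0 => r0.
  by rewrite Pz r0 mulr0 oppr0 normr0.
have [b [sb b1 Pb]] := IH D mD szD dD.
exists (rcons b c^*); split.
- by rewrite size_rcons sb.
- move=> x; rewrite mem_rcons inE => /orP[/eqP ->|/b1 //].
  by rewrite norm_conjC.
rewrite PhiS nth_rcons sb ltnn eqxx conjCK.
have -> : Phi (rcons b c^*) n = D.
  rewrite -Pb; apply: Phi_eq => i; rewrite -sb => ib.
  by rewrite nth_rcons ib.
(* Reversing the formula for zD swaps P and P^* and conjugates c; in zD - c D^* the P^* terms cancel
   and P keeps the factor (1 - |c|^2) / d = 1. *)
rewrite -reversedXM XD reversedZ fmorphV /= dR reversedD reversedZ reversedK ?sP //.
rewrite -[RHS]scale1r -(mulVf d0) /d normCK.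
rewrite -!mul_polyC !rmorphM !rmorphB /= rmorph1.
move: (reversed _ _) => P'; ring.
Qed.

End Szego.

(** * Arguments on the unit circle *)

Section Circle.
Variable R : realType.
Implicit Types (s t u x : R) (z c : R[i]).

Lemma expiD s t : expi (s + t) = expi s * expi t.
Proof. by rewrite /expi cosD sinD [sin s * _ + _]addrC. Qed.

Lemma expi0 : expi 0 = 1 :> R[i].
Proof. by rewrite /expi cos0 sin0. Qed.

Lemma expi_pi : expi pi = -1 :> R[i].
Proof.
by rewrite /expi cospi sinpi; apply/eqP; rewrite eq_complex /= oppr0 !eqxx.
Qed.

Lemma expi_2pi : expi (2 * pi) = 1 :> R[i].
Proof. by rewrite mulr_natl mulr2n expiD expi_pi mulrNN mulr1. Qed.

Lemma norm_expi t : `|expi t| = 1.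
Proof. by rewrite normc_def /= cos2Dsin2 sqrtr1. Qed.

Lemma expi_neq0 t : expi t != 0.
Proof. by rewrite -normr_eq0 norm_expi oner_eq0. Qed.

Lemma expiN t : expi (- t) = (expi t)^-1.
Proof.
by apply: (mulIf (expi_neq0 t)); rewrite -expiD addNr expi0 mulVf ?expi_neq0.
Qed.

Lemma expiMn t n : expi (t *+ n) = expi t ^+ n.
Proof. by elim: n => [|n IH]; rewrite ?expi0 // mulrS expiD IH exprS. Qed.

Lemma expiMz (k : int) : expi (k%:~R * (2 * pi)) = 1 :> R[i].
Proof.
rewrite mulrzl; case: k => n.
  by rewrite -pmulrn expiMn expi_2pi expr1n.
by rewrite NegzE mulrNz expiN -pmulrn expiMn expi_2pi expr1n invr1.
Qed.

Lemma expiD2pi t (k : int) : expi (t + k%:~R * (2 * pi)) = expi t.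
Proof. by rewrite expiD expiMz mulr1. Qed.

Lemma expi_sum (I : Type) (r : seq I) (P : pred I) (F : I -> R) :
  expi (\sum_(i <- r | P i) F i) = \prod_(i <- r | P i) expi (F i).
Proof. exact: (big_morph _ expiD expi0). Qed.

Lemma expi_eq1 t : 0 <= t < 2 * pi -> expi t = 1 -> t = 0.
Proof.
move=> /andP[t0 t2] /(congr1 (@complex.Re R)) /= c1.
have half : sin (t / 2) = 0.
  apply/eqP; rewrite -sqrf_eq0 sin2cos2.
  have tE : t = (t / 2) *+ 2 by field.
  move: c1; rewrite {1}tE cos_mulr2n => c1.
  by apply/eqP; lra.
have [//|tgt0] := eqVneq t 0.
suff : 0 < sin (t / 2) by rewrite half ltxx.
apply: sin_gt0_pi; rewrite divr_gt0 ?lt0r ?tgt0 //=; lra.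
Qed.

Lemma expi_eq s t : expi s = expi t ->
  exists k : int, s = t + k%:~R * (2 * pi).
Proof.
move=> st; exists (Num.floor ((s - t) / (2 * pi))).
set k := Num.floor _.
have p2 : 0 < 2 * pi :> R by rewrite mulr_gt0 // pi_gt0.
have /andP[k1 k2] : k%:~R * (2 * pi) <= s - t < (k + 1)%:~R * (2 * pi).
  by rewrite -ler_pdivlMr // -ltr_pdivrMr // floor_itv.
apply/subr0_eq; apply: expi_eq1.
  by rewrite intrD in k2; apply/andP; split; lra.
by rewrite opprD addrA expiD [expi (- (_ * _))]expiN expiMz invr1 mulr1 expiD expiN st
  divff ?expi_neq0.
Qed.

Lemma expi_inj_near s t : `|s - t| < 2 * pi -> expi s = expi t -> s = t.
Proof.
move=> st /expi_eq[k sE].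
have p2 : 0 < 2 * pi :> R by rewrite mulr_gt0 // pi_gt0.
move: st; rewrite sE addrC addKr normrM (gtr0_norm p2) gtr_pMl //.
rewrite -intr_norm -[1]/(1%:~R) ltr_int => k1.
have -> : k = 0 by lia.
by rewrite mul0r addr0.
Qed.

Lemma expi_surj z : `|z| = 1 -> exists t, z = expi t.
Proof.
case: z => a b; rewrite normc_def => -[/(congr1 (fun x => x ^+ 2))].
rewrite sqr_sqrtr ?addr_ge0 ?sqr_ge0 //= expr1n => ab.
have a1 : -1 <= a <= 1 by nra.
have ca : cos (acos a) = a by rewrite acosK // in_itv.
have sa : sin (acos a) = Num.sqrt (b ^+ 2) by rewrite sin_acos // -ab addrAC subrr add0r.
have [b0|b0] := leP 0 b.
  by exists (acos a); rewrite /expi ca sa sqrtr_sqr ger0_norm.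
by exists (- acos a); rewrite /expi cosN sinN ca sa sqrtr_sqr ltr0_norm // opprK.
Qed.

(** Chord formula: the direction depends on the mean argument, the signed length is a sine. The
    signs of such sines later make the weights nonnegative. *)
Lemma expiB s t :
  expi s - expi t = expi ((s + t) / 2) * (2 * 'i%C * (sin ((s - t) / 2))%:C%C).
Proof.
set u := (s + t) / 2; set v := (s - t) / 2.
have -> : s = u + v by rewrite /u /v; field.
have -> : t = u - v by rewrite /u /v; field.
rewrite /expi cosD cosB sinD sinB; apply/eqP; rewrite eq_complex /=.
by apply/andP; split; apply/eqP; ring.
Qed.

(** On the circle the numerator is expi x times the conjugate of the denominator 1 - c expi x. The
    latter has positive real part, so atan gives a global branch of the argument; the derivative of
    [h] is a Poisson kernel, hence positive. *)
Lemma mobius_lift c : `|c| < 1 -> exists h : R -> R,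
  [/\ continuous h, {homo h : x y / x < y},
      forall x, h (x + 2 * pi) = h x + 2 * pi &
      forall x, 1 - c * expi x != 0 /\
        expi x - c^* = expi (h x) * (1 - c * expi x)].
Proof.
case: c => p q; rewrite normc_def ltcR -[X in _ < X]sqrtr1 ltr_sqrt // => pq.
(* [D x] and [- M x] are the real and imaginary parts of 1 - c expi x. *)
pose D x := 1 - (p * cos x - q * sin x); pose M x := p * sin x + q * cos x.
have DM x : D x ^+ 2 + M x ^+ 2 = 2 * D x - 1 + (p ^+ 2 + q ^+ 2).
  transitivity (2 * D x - 1 + (p ^+ 2 + q ^+ 2) * (cos x ^+ 2 + sin x ^+ 2)).
    by rewrite /D /M; ring.
  by rewrite cos2Dsin2 mulr1.
rewrite /= in pq.
(* [DM] reads 2 D = D^2 + M^2 + 1 - |c|^2. *)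
have D0 x : 0 < D x.
  by have := DM x; have := sqr_ge0 (D x); have := sqr_ge0 (M x); lra.
have DM0 x : 0 < D x ^+ 2 + M x ^+ 2.
  by rewrite ltr_pwDl ?sqr_ge0 // exprn_gt0.
pose h x : R := x + 2 * atan (M x / D x).
pose dh x : R := (1 - (p ^+ 2 + q ^+ 2)) / (D x ^+ 2 + M x ^+ 2).
have dM x : is_derive x (1 : R) M (1 - D x).
  apply: is_derive_eq; rewrite /D /GRing.scale /=; ring.
have dD x : is_derive x (1 : R) D (M x).
  apply: is_derive_eq; rewrite /M /GRing.scale /=; ring.
have dhP x : is_derive x (1 : R) h (dh x).
  have Dx := lt0r_neq0 (D0 x).
  have dV : is_derive x (1 : R) (fun y => (D y)^-1) (- (D x) ^- 2 * M x).
    exact: is_deriveV.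
  apply: is_derive_eq.
  have -> : dh x = (2 * D x - (D x ^+ 2 + M x ^+ 2)) / (D x ^+ 2 + M x ^+ 2).
    by rewrite /dh DM; congr (_ / _); ring.
  by rewrite /GRing.scale /=; field; rewrite Dx lt0r_neq0.
have hd x : derivable h x 1 by have [] := dhP x.
have ch : continuous h.
  by move=> x; apply/differentiable_continuous/derivable1_diffP.
exists h; split=> // [x y xy|x|x].
- apply: (@gtr0_derive1_lt_cc _ h x y) => //; last 3 first.
  + exact: continuous_subspaceT.
  + by rewrite in_itv /= lexx ltW.
  + by rewrite in_itv /= lexx ltW.
  + move=> z _; rewrite derive1E derive_val divr_gt0 //.
    by rewrite subr_gt0.
- by rewrite /h /M /D mulr_natl cosD2pi sinD2pi addrAC.
have DMx : 1 - (p +i* q)%C * expi x = Complex (D x) (- M x).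
  by apply/eqP; rewrite eq_complex /= /D /M; apply/andP; split; apply/eqP; ring.
split.
  rewrite DMx; apply/eqP => /(congr1 (@complex.Re R)) /= D0x.
  by have := D0 x; rewrite D0x ltxx.
set t := atan (M x / D x).
have ct : 0 < cos t by apply: cos_gt0_pihalf; rewrite atan_gtNpi2 atan_ltpi2.
have MD : M x * cos t = D x * sin t.
  have := atanK (M x / D x); rewrite -/t /tan => /eqP.
  rewrite eqr_div ?lt0r_neq0 // => /eqP <-; exact: mulrC.
have key : Complex (D x) (M x) = expi (2 * t) * Complex (D x) (- M x).
  rewrite mulr_natl mulr2n /expi cosD sinD; apply/eqP; rewrite eq_complex /=.
  have := cos2Dsin2 t; set c := cos t in ct MD *; set s := sin t in MD * => cs.
  apply/andP; split; apply/eqP; apply: (mulIf (lt0r_neq0 ct)).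
    transitivity ((c * c - s * s) * (D x * c) + (c * s + s * c) * (M x * c)).
      by rewrite MD -[LHS]mulr1 -cs; ring.
    ring.
  transitivity ((c * s + s * c) * (D x * c) - (c * c - s * s) * (M x * c)).
    by rewrite MD -[LHS]mulr1 -cs; ring.
  ring.
rewrite /h -/t expiD -mulrA DMx -key.
apply: (mulIf (expi_neq0 (- x))).
rewrite mulrBl -expiD subrr expi0 mulrAC -expiD subrr expi0 mul1r.
apply/eqP; rewrite eq_complex /= cosN sinN /D /M.
by apply/andP; split; apply/eqP; ring.
Qed.

End Circle.

(** * The phase of the Blaschke product *)

Section Phase.
Variable R : realType.
Implicit Types (s t u x : R) (z lam : R[i]) (b : seq R[i]).

(** [eta] is the argument of B_n = z Phi_n / Phi_n^* on the circle. The recursion becomes B_{n+1} =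
    z (B_n - conj b_n) / (1 - b_n B_n): a disk automorphism, then a factor z that adds one to the
    winding number. *)
Lemma szego_phase b n : (forall i, (i < n)%N -> `|b`_i| < 1) ->
  exists eta : R -> R,
    [/\ continuous eta, {homo eta : x y / x < y},
        forall t, eta (t + 2 * pi) = eta t + n.+1%:R * (2 * pi) &
        forall t, (reversed n (Phi b n)).[expi t] != 0 /\
          expi t * (Phi b n).[expi t] =
          expi (eta t) * (reversed n (Phi b n)).[expi t]].
Proof.
elim: n => [_|n IH bn].
  exists id; split=> // [|t|t].
  - by move=> t; exact: cvg_id.
  - by rewrite mul1r.
  - by rewrite /= reversed01 hornerC oner_eq0.
have [i ni|eta [ceta ieta peta etaE]] := IH; first exact/bn/(ltn_trans ni).
have [h [ch ih ph hE]] := mobius_lift (bn n (leqnn _)).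
have phn x k : h (x + k%:R * (2 * pi)) = h x + k%:R * (2 * pi).
  elim: k => [|k IHk]; first by rewrite mul0r !addr0.
  by rewrite -natr1 mulrDl mul1r addrA ph IHk addrA.
exists (fun t => t + h (eta t)); split=> [t|t u tu|t|t].
- by apply: cvgD; [exact: cvg_id|exact: continuous_comp (ceta t) (ch _)].
- by rewrite ltrD // ih // ieta.
- by rewrite peta phn -[n.+2%:R]natr1; ring.
have [r0 rE] := etaE t; have [c0 cE] := hE (eta t).
rewrite reversed_PhiS PhiS !(hornerD, hornerN, hornerZ, hornerM, hornerX) rE.
have -> : (reversed n (Phi b n)).[expi t] -
    b`_n * (expi (eta t) * (reversed n (Phi b n)).[expi t]) =
    (1 - b`_n * expi (eta t)) * (reversed n (Phi b n)).[expi t] by ring.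
split; first by rewrite mulf_neq0.
by rewrite expiD -!mulrA [expi (h _) * _]mulrA -cE mulrBl.
Qed.

(* [S] enumerates, clockwise, all the arguments of a set of [m] points of the
   circle, so that adding [m] to the index is a full turn. *)
Definition arg_lift (m : nat) (S : int -> R) : Prop :=
  (forall i, S (i + 1) < S i) /\ (forall i, S (i + m%:Z) = S i - 2 * pi).

Definition points (S : int -> R) : set R[i] := range (fun i => expi (S i)).

(** The indexing makes [F i] the first argument of F met going clockwise, that is downwards, from
    [S i]. *)
Definition interlaced (m : nat) (S F : int -> R) : Prop :=
  [/\ arg_lift m S, arg_lift m F & forall i, S (i + 1) < F i < S i].

(** The shift rule makes f exceed every bound in both directions, and the intermediate value theorem
    applies on [- k a, k a] for large k. *)
Lemma shift_surj (f : R -> R) (a b : R) : continuous f -> 0 <= a ->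
  0 < b -> (forall t, f (t + a) = f t + b) -> forall v, exists t, f t = v.
Proof.
move=> cf a0 b0 fab v.
have fn t k : f (t + a *+ k) = f t + b *+ k.
  elim: k => [|k IHk]; first by rewrite !addr0.
  by rewrite !mulrSr !addrA fab IHk.
have [k /andP[kl kr]] : exists k : nat, - (b *+ k) <= v - f 0 <= b *+ k.
  exists (Num.truncn `|(v - f 0) / b|).+1; rewrite -ler_norml -mulr_natl.
  rewrite -ler_pdivrMr // -{1}(gtr0_norm b0) -normf_div.
  by rewrite ltW // truncnS_gt.
have fk : f (- (a *+ k)) = f 0 - b *+ k.
  by rewrite -(subrK (a *+ k) 0) fn sub0r addrK.
have [|||t _ ft] := @IVT _ f (- (a *+ k)) (a *+ k) v.
- by rewrite ge0_cp // mulrn_wge0.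
- exact: continuous_subspaceT.
- have := fn 0 k; rewrite add0r fk => ->; rewrite ge_min le_max.
  by apply/andP; split; apply/orP; [left|right]; lra.
by exists t.
Qed.

(** The zeros are the points where expi (eta t) is conj lam, respectively - conj lam: preimages
    under the increasing [eta] of two progressions of step 2 pi offset by pi. *)
Lemma POPUC_interlaced b n lam : (forall i, (i < n)%N -> `|b`_i| < 1) ->
  `|lam| = 1 -> exists S F : int -> R,
    [/\ interlaced n.+1 S F,
        forall t, root (POPUC n b lam) (expi t) <-> exists k, t = S k &
        forall t, root (POPUC n b (- lam)) (expi t) <-> exists k, t = F k].
Proof.
move=> b1 l1; have [eta [ceta ieta peta etaE]] := szego_phase b1.
have p0 := pi_gt0 R.
have np : 0 < n.+1%:R * (2 * pi) :> R by rewrite !mulr_gt0.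
have pp : 0 <= 2 * pi :> R by rewrite ltW // mulr_gt0.
have sur := shift_surj ceta pp np peta.
have mono : {mono eta : x y / x < y} := leW_mono (le_mono ieta).
have inj : injective eta := inc_inj (le_mono ieta).
have lift s G : (forall i : int, eta (G i) = s - i%:~R * (2 * pi)) ->
    arg_lift n.+1 G.
  move=> GE; split=> i; first by rewrite -mono !GE intrD; lra.
  apply: inj; rewrite GE.
  have := peta (G i - 2 * pi); rewrite subrK GE.
  rewrite intrD /=; lra.
have zE mu s G : mu^* = expi s ->
    (forall i : int, eta (G i) = s - i%:~R * (2 * pi)) ->
    forall t, root (POPUC n b mu) (expi t) <-> exists k, t = G k.
  move=> muE GE t; rewrite rootE /POPUC.
  rewrite !(hornerD, hornerN, hornerZ, hornerM, hornerX).
  have [r0 ->] := etaE t.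
  rewrite -mulrBl mulf_eq0 (negPf r0) orbF subr_eq0 muE.
  split=> [/eqP/expi_eq[k kE]|[k ->]].
    by exists (- k); apply: inj; rewrite kE GE; ring.
  by rewrite GE -(expiD2pi s (- k)); apply/eqP; congr expi; ring.
have [L LE] : exists L, lam^* = expi L by apply: expi_surj; rewrite norm_conjC.
(* Subtracting i full turns makes the enumeration decreasing, hence clockwise. *)
have [S SE] := choice (fun i : int => sur (L - i%:~R * (2 * pi))).
have [F FE] := choice (fun i : int => sur (L - pi - i%:~R * (2 * pi))).
exists S, F; split.
- split; [exact: lift SE|exact: lift FE|] => i.
  by apply/andP; split; rewrite -mono SE FE ?intrD; lra.
- exact: zE LE SE.
- apply: zE FE.
  by rewrite rmorphN /= LE expiD expiN expi_pi invrN1 mulrN1.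
Qed.

End Phase.

(** * Interlacing points and their arguments *)

Section Interlaced.
Variable R : realType.
Implicit Types (s t u x : R) (z lam : R[i]) (S F : int -> R) (m : nat).

(** Other arguments of the endpoints differ by k and l turns, and both intervals having length in
    ]0, 2 pi] forces k = l. One choice of arguments thus describes the arc. *)
Lemma arc_expi s t z : t < s <= t + 2 * pi ->
  clockwise_arc (expi s) (expi t) z <-> exists2 u, t < u < s & z = expi u.
Proof.
move=> /andP[ts st]; split; last first.
  by move=> [u tus ->]; exists s, t, u.
move=> [s' [t' [u [/esym/expi_eq[k ->] /esym/expi_eq[l ->] ->]]]] /andP[tu us] le.
have p2 : 0 < 2 * pi :> R by rewrite mulr_gt0 // pi_gt0.
have lk : l < k + 1.
  rewrite -(ltr_int R) -(ltr_pM2r p2) intrD; lra.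
have kl : k < l + 1.
  rewrite -(ltr_int R) -(ltr_pM2r p2) intrD; lra.
have kE : k = l by lia.
exists (u - k%:~R * (2 * pi)); last first.
  by rewrite -(expiD2pi (u - _) k) subrK.
by rewrite kE in us *; apply/andP; split; lra.
Qed.

Lemma clockwise_ordered_inj m (w : 'I_m -> R[i]) :
  clockwise_ordered w -> injective w.
Proof.
move=> [th [wE thd thp]].
have H (i j : 'I_m) : (i < j)%N -> w i != w j.
  move=> /thd ij; rewrite !wE; apply/eqP => /expi_inj_near.
  rewrite ger0_norm ?subr_ge0 ?(ltW ij) // ltrBlDl => /(_ (thp _ _)) E.
  by rewrite E ltxx in ij.
move=> i j SE; apply/val_inj/eqP => /=.
have [ij|ji|//] := ltngtP (i : nat) j.
  by have := H _ _ ij; rewrite SE eqxx.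
by have := H _ _ ji; rewrite SE eqxx.
Qed.

Section Lift.
Variables (m : nat) (S : int -> R).
Hypothesis lS : arg_lift m S.

Lemma lift_le : {mono S : i j /~ i <= j}.
Proof.
have dS i (k : nat) : S (i + k.+1%:Z) < S i.
  elim: k => [|k IH]; first exact: lS.1.
  rewrite -[k.+2]addn1 PoszD addrA; exact: lt_trans (lS.1 _) IH.
apply: le_nmono => i j ij.
have -> : i = j + (`|i - j|%N.-1).+1%:Z by lia.
exact: dS.
Qed.

Lemma lift_lt : {mono S : i j /~ i < j}.
Proof. exact: leW_nmono lift_le. Qed.

Lemma lift_turn i (k : int) : S (i + k * m%:Z) = S i - k%:~R * (2 * pi).
Proof.
have H j (l : nat) : S (j + l%:Z * m%:Z) = S j - l%:R * (2 * pi).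
  elim: l => [|l IH]; first by rewrite !mul0r addr0 subr0.
  rewrite -[l.+1]addn1 PoszD mulrDl mul1r addrA lS.2 IH natrD; lra.
case: k => k; first exact: H.
by rewrite -[in RHS](addrK (Negz k * m%:Z) i) NegzE mulNr opprK H; ring.
Qed.

Lemma lift_args u i : expi u = expi (S i) -> exists k, u = S k.
Proof.
move=> /expi_eq[k ->]; exists (i + (- k) * m%:Z).
by rewrite lift_turn rmorphN /= mulNr opprK.
Qed.

Lemma lift_lt2pi i j : j < i + m%:Z -> S i < S j + 2 * pi.
Proof.
move=> ij; have : S (i + m%:Z) < S j by rewrite lift_lt.
by rewrite lS.2; lra.
Qed.

Lemma lift_clockwise : clockwise_ordered (fun j : 'I_m => expi (S j%:Z)).
Proof.
exists (fun j => S j%:Z); split=> // j k; first by move=> jk; rewrite lift_lt.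
by apply: lift_lt2pi; have := ltn_ord j; have := ltn_ord k; lia.
Qed.

Lemma lift_ord_inj : injective (fun j : 'I_m => expi (S j%:Z)).
Proof. exact: clockwise_ordered_inj lift_clockwise. Qed.

Lemma lift_range : (0 < m)%N ->
  range (fun j : 'I_m => expi (S j%:Z)) = points S.
Proof.
move=> m0; apply/seteqP; split=> _ [j _ <-]; first by exists j%:Z.
have mod0 : 0 <= (j %% m%:Z)%Z by rewrite modz_ge0 //; lia.
have jm : (`|(j %% m%:Z)%Z|%N < m)%N.
  by rewrite -ltz_nat gez0_abs // ltz_pmod.
exists (Ordinal jm) => //=; rewrite gez0_abs //.
rewrite -(expiD2pi _ (- (j %/ m%:Z)%Z)) rmorphN mulNr /= -lift_turn.
by rewrite addrC -divz_eq.
Qed.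

End Lift.

Section Interlacing.
Variables (m : nat) (S F : int -> R).
Hypothesis SF : interlaced m S F.

Let lS : arg_lift m S. Proof. by case: SF. Qed.
Let lF : arg_lift m F. Proof. by case: SF. Qed.
Let SFS i : S (i + 1) < F i < S i. Proof. by case: SF. Qed.

(** The index shift is forced: between F (i + 1) and F i lies S (i + 1). *)
Lemma interlaced_swap : interlaced m F (fun i => S (i + 1)).
Proof.
split=> // [|i].
  by split=> i; [exact: lS.1|rewrite addrAC lS.2].
by have /andP[-> _] := SFS i; have /andP[_ ->] := SFS (i + 1).
Qed.

Lemma interlaced_between i k : S (i + 1) < F k < S i -> k = i.
Proof.
move=> /andP[ik ki]; have /andP[k1 k2] := SFS k.
have : k < i + 1 by rewrite -(lift_lt lS) (lt_trans ik).
have : i < k + 1 by rewrite -(lift_lt lS) (lt_trans k1).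
lia.
Qed.

Lemma interlaced_disjoint : points S `&` points F = set0.
Proof.
apply/seteqP; split=> // _ [[i _ <-] [k _ /(lift_args lS)[j FS]]].
have /andP[] := SFS k; rewrite FS !(lift_lt lS); lia.
Qed.

(** An arc free of S-points runs from some S i to S (i + 1), and F i is the only argument of F in
    between. *)
Lemma interlaced_arc : (0 < m)%N ->
  one_in_each_arc (points S) (points F).
Proof.
move=> m0 _ _ [i _ <-] [j _ <-] /= arc0.
(* The index congruent to j modulo m in [i + 1, i + m]; for coinciding endpoints it is i + m, a full
   turn, and not i. *)
pose j' := i + 1 + ((j - i - 1) %% m%:Z)%Z.
have jE : expi (S j) = expi (S j').
  set q := ((j - i - 1) %/ m%:Z)%Z.
  have SE : S j = S j' - q%:~R * (2 * pi).
    rewrite -(lift_turn lS); congr S.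
    by rewrite /j' /q; have := divz_eq (j - i - 1) m%:Z; lia.
  by rewrite -(expiD2pi (S j) q) SE subrK.
have j1 : i + 1 <= j' by rewrite lerDl modz_ge0 //; lia.
have j2 : j' <= i + m%:Z.
  have : ((j - i - 1) %% m%:Z)%Z < m%:Z by apply: ltz_pmod; lia.
  by rewrite /j'; lia.
rewrite jE in arc0 *.
have ij : S j' < S i <= S j' + 2 * pi.
  rewrite (lift_lt lS) -lerBlDr -lS.2 (lift_le lS).
  by rewrite j2 andbT; lia.
have j'E : j' = i + 1.
  apply/eqP; rewrite eq_le j1 andbT leNgt; apply/negP => ij'.
  have : (clockwise_arc (expi (S i)) (expi (S j')) `&` points S)
      (expi (S (i + 1))).
    split; last by exists (i + 1).
    by apply/(arc_expi _ ij); exists (S (i + 1)) => //; rewrite !(lift_lt lS); lia.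
  by rewrite arc0.
exists (expi (F i)); split.
  split; first by exists i.
  by apply/(arc_expi _ ij); exists (F i) => //; rewrite j'E.
move=> _ [[k _ <-] /(arc_expi _ ij)[u uS /= kE]].
have [l uE] := lift_args lF (esym kE).
by rewrite kE uE (@interlaced_between i l) // -uE -j'E.
Qed.

End Interlacing.

Lemma interlaced_strictly m S F (w y : 'I_m -> R[i]) : (0 < m)%N ->
  interlaced m S F -> injective w -> injective y ->
  range w = points S -> range y = points F -> strictly_interlace w y.
Proof.
move=> m0 SF wi yi wS yF.
have onS (G : int -> R) (v : 'I_m -> R[i]) j : range v = points G -> `|v j| = 1.
  move=> vG; have : range v (v j) by exists j.
  by rewrite vG => -[i _ <-]; rewrite norm_expi.
split=> //; rewrite ?wS ?yF.
- by move=> j; rewrite (onS _ _ _ wS) (onS _ _ _ yF).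
- exact: interlaced_disjoint SF.
- exact: interlaced_arc SF m0.
- have -> : points S = points (fun i => S (i + 1)).
    apply/seteqP; split=> _ [i _ <-]; last by exists (i + 1).
    by exists (i - 1) => //; rewrite subrK.
  exact: interlaced_arc (interlaced_swap SF) m0.
Qed.

Lemma interlaced_first m S F k : interlaced m S F -> (0 < m)%N ->
  ~ clockwise_arc (expi (S 0)) (expi (F 0)) (expi (F k)).
Proof.
move=> SF m0; have [lS lF SFS] := SF.
have /andP[S1 S0] := SFS 0.
have FS : F 0 < S 0 <= F 0 + 2 * pi.
  rewrite S0 -lerBlDr -lS.2 ltW //; apply: le_lt_trans S1.
  by rewrite (lift_le lS); lia.
move=> /(arc_expi _ FS)[u uS kE].
have [l uE] := lift_args lF (esym kE).
have l0 : l = 0.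
  apply: (interlaced_between SF); rewrite -uE.
  by have /andP[u1 ->] := uS; rewrite (lt_trans S1).
by move: uS; rewrite uE l0 ltxx.
Qed.

End Interlaced.

(** * Polynomials with prescribed zeros on the circle *)

Section ProductOfRoots.
Variable C : numClosedFieldType.
Implicit Types (P Q : {poly C}) (m n : nat).

Definition node_poly m (w : 'I_m -> C) : {poly C} :=
  \prod_(j < m) ('X - (w j)%:P).

Lemma node_polyE m (w : 'I_m -> C) :
  node_poly w = \prod_(x <- codom w) ('X - x%:P).
Proof. by rewrite big_map big_enum. Qed.

Lemma node_poly_monic m (w : 'I_m -> C) : node_poly w \is monic.
Proof. by rewrite node_polyE monic_prod_XsubC. Qed.

Lemma size_node_poly m (w : 'I_m -> C) : size (node_poly w) = m.+1.
Proof. by rewrite node_polyE size_prod_XsubC size_codom card_ord. Qed.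

Lemma zeros_node_poly m (w : 'I_m -> C) : zeros (node_poly w) = range w.
Proof.
rewrite node_polyE; apply/seteqP; split=> z; rewrite /zeros /= root_prod_XsubC.
  by move=> /codomP[j ->]; exists j.
by move=> [j _ <-]; exact: codom_f.
Qed.

Lemma horner0_node_poly m (w : 'I_m -> C) :
  (node_poly w).[0] = (-1) ^+ m * \prod_(j < m) w j.
Proof.
rewrite horner_prod -[X in _ ^+ X]card_ord -prodrN.
by apply: eq_bigr => j _; rewrite hornerXsubC sub0r.
Qed.

Lemma monic_node_poly m P (w : 'I_m -> C) : P \is monic -> size P = m.+1 ->
  injective w -> (forall j, root P (w j)) -> P = node_poly w.
Proof.
move=> mP sP wi wP; rewrite node_polyE.
rewrite -[RHS]scale1r -(monicP mP); apply: all_roots_prod_XsubC.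
- by rewrite sP size_codom card_ord.
- by apply/allP => _ /codomP[j ->].
- by rewrite uniq_rootsE map_inj_uniq ?enum_uniq.
Qed.

Lemma node_poly_unique m P (w : 'I_m -> C) : P \is monic -> size P = m.+1 ->
  injective w -> zeros P = range w -> P = node_poly w.
Proof.
move=> mP sP wi wP; apply: monic_node_poly => // j.
have : range w (w j) by exists j.
by rewrite -wP.
Qed.

(** For |w| = 1 the factor z - w reverses to - conj(w) (z - w), and the constants multiply to conj
    P(0). *)
Lemma reversed_node_poly m (w : 'I_m -> C) : (forall j, `|w j| = 1) ->
  reversed m (node_poly w) = ((node_poly w).[0])^* *: node_poly w.
Proof.
move=> w1; apply: poly_eq_neq0 => z z0.
rewrite reversed_hornerE ?size_node_poly // hornerZ !horner_prod !rmorph_prod /=.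
have -> : z ^+ m = \prod_(j < m) z by rewrite prodr_const card_ord.
rewrite -!big_split; apply: eq_bigr => j _ /=.
rewrite !hornerXsubC sub0r !rmorphB rmorphN fmorphV /= conjCK.
have ww : w j * (w j)^* = 1 by rewrite -normCK w1 expr1n.
rewrite mulrBr divff // mulNr mulrBr [_ * w j]mulrC ww opprB.
by rewrite [z * _]mulrC.
Qed.

(* Partial fractions: [Q / P] is the sum of [mu j * (z + w j) / (z - w j)],
   with nonnegative weights, so its real part is nonnegative for [`|z| >= 1]
   and it never takes the value [-1]. *)
Lemma disk_zeros_node_polyD m (w y mu : 'I_m -> C) :
  injective w -> (forall j, `|w j| = 1) -> (forall j k, w j != y k) ->
  (forall j, 0 <= mu j) ->
  (forall j, (node_poly y).[w j] =
    2 * w j * mu j * \prod_(k < m | k != j) (w j - w k)) ->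
  (node_poly w + node_poly y).[0] = 0 ->
  disk_zeros (node_poly w + node_poly y).
Proof.
move=> wi w1 wy mu0 muE PQ0.
pose Pj j := \prod_(k < m | k != j) ('X - (w k)%:P).
have w0 j : w j != 0 by rewrite -normr_gt0 w1.
have PE j : node_poly w = ('X - (w j)%:P) * Pj j by rewrite /node_poly (bigD1 j).
have sPj j : size (Pj j) = m.
  have := size_node_poly w; rewrite (PE j) size_Mmonic ?polyXsubC_eq0 //.
  - by rewrite size_XsubC => -[].
  - by rewrite monic_prod // => k _; exact: monicXsubC.
have Pj_w j k : k != j -> (Pj j).[w k] = 0.
  by move=> kj; rewrite horner_prod (bigD1 k) //= hornerXsubC subrr mul0r.
(* Lagrange interpolation at the w's: both node polynomials are monic, so their difference has
   degree below m. *)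
have QE : node_poly y = node_poly w + \sum_j (2 * mu j * w j) *: Pj j.
  apply/subr0_eq; rewrite opprD addrA.
  set G := \sum_j _.
  apply: (@roots_geq_poly_eq0 _ _ (codom w)).
  - apply/allP => _ /codomP[j ->]; rewrite rootE !hornerD !hornerN.
    rewrite (PE j) hornerM hornerXsubC subrr mul0r subr0.
    rewrite /G horner_sum (bigD1 j) //= big1 ?addr0 => [|k kj]; last first.
      by rewrite hornerZ Pj_w 1?eq_sym // mulr0.
    rewrite hornerZ muE horner_prod.
    under [X in _ - _ * X]eq_bigr do rewrite hornerXsubC.
    by apply/eqP; ring.
  - by rewrite map_inj_uniq ?enum_uniq.
  - rewrite size_codom card_ord (leq_trans (size_polyD _ _)) // geq_max.
    apply/andP; split.
      apply/leq_sizeP => i; rewrite leq_eqVlt coefB => /orP[/eqP <-|mi].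
        rewrite !(@monic_coef _ m) ?node_poly_monic ?size_node_poly //.
        by rewrite subrr.
      by rewrite !nth_default ?size_node_poly // subrr.
    rewrite size_polyN; apply: (leq_trans (size_sum _ _ _)).
    apply/bigmax_leqP => j _.
    by rewrite (leq_trans (size_scale_leq _ _)) // sPj.
have sumE z : (node_poly w).[z] != 0 -> (node_poly w + node_poly y).[z] =
    (node_poly w).[z] * (2 + \sum_j 2 * mu j * w j / (z - w j)).
  move=> Pz; rewrite hornerD QE hornerD addrA mulrDr mulr_natr mulr2n.
  rewrite horner_sum mulr_sumr; congr (_ + _); apply: eq_bigr => j _.
  have zw : z - w j != 0.
    by apply: contraNneq Pz => zw; rewrite (PE j) hornerM hornerXsubC zw mul0r.
  by rewrite hornerZ (PE j) hornerM hornerXsubC; field.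
have P0 : (node_poly w).[0] != 0.
  rewrite horner0_node_poly mulf_neq0 ?signr_eq0 //.
  by rewrite prodf_seq_neq0; apply/allP => j _ /=.
(* Evaluation at 0, where P + Q vanishes and each w / (z - w) equals -1. *)
have mu1 : \sum_j mu j = 1.
  have /eqP := sumE _ P0; rewrite PQ0 eq_sym mulf_eq0 (negPf P0) /= => /eqP.
  under eq_bigr => j _ do rewrite sub0r invrN mulrN mulfK //.
  rewrite sumrN -mulr_sumr -{1}[2]mulr1 -mulrBr => /eqP.
  by rewrite mulf_eq0 pnatr_eq0 /= subr_eq0 => /eqP.
move=> z z1; have [Pz|Pz] := eqVneq (node_poly w).[z] 0.
  have : zeros (node_poly w) z by apply/eqP.
  rewrite zeros_node_poly => -[j _ <-]; rewrite hornerD (PE j) hornerM hornerXsubC.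
  rewrite subrr mul0r add0r horner_prod prodf_seq_neq0; apply/allP => k _ /=.
  by rewrite hornerXsubC subr_eq0 wy.
rewrite sumE // mulf_neq0 //.
have zw j : z - w j != 0.
  by apply: contraNneq Pz => zw; rewrite (PE j) hornerM hornerXsubC zw mul0r.
pose x j := (z + w j) / (z - w j).
(* Since (z + w) / (z - w) = 1 + 2 w / (z - w), one of the two units is spread over the weights. *)
have -> : 2 + \sum_j 2 * mu j * w j / (z - w j) = 1 + \sum_j mu j * x j.
  rewrite {1}mulr2n -addrA; congr (_ + _).
  rewrite -{1}mu1 -big_split; apply: eq_bigr => j _ /=.
  by rewrite /x; field.
rewrite addrC addr_eq0; apply/eqP => sN1.
have x0 j : 0 <= x j + (x j)^*.
  have zwc : z^* - (w j)^* != 0 by rewrite -rmorphB /= conjC_eq0.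
  have -> : x j + (x j)^* = 2 * (`|z| ^+ 2 - `|w j| ^+ 2) / `|z - w j| ^+ 2.
    rewrite /x fmorph_div !normCK !rmorphB rmorphD /=; field.
    by apply/andP.
  rewrite w1 expr1n divr_ge0 ?exprn_ge0 // mulr_ge0 ?ler0n //.
  by rewrite subr_ge0 expr_ge1.
have : 0 <= \sum_j mu j * (x j + (x j)^*).
  by apply: sumr_ge0 => j _; rewrite mulr_ge0.
under eq_bigr => j _ do rewrite mulrDr.
rewrite big_split /= sN1.
have -> : \sum_j mu j * (x j)^* = (\sum_j mu j * x j)^*.
  rewrite rmorph_sum; apply: eq_bigr => j _.
  by rewrite rmorphM /= (conj_Creal (ger0_real (mu0 j))).
by rewrite sN1 rmorphN1 -opprD oppr_ge0 lt_geF // addr_gt0.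
Qed.

End ProductOfRoots.

(** * From Verblunsky coefficients to interlacing zeros *)

Section Direct.
Variables (R : realType) (n : nat) (a : n.-tuple R[i]) (lam : R[i]).
Hypotheses (a1 : forall j, `|tnth a j| < 1) (lam1 : `|lam| = 1).

Lemma POPUC_zeros : exists S F : int -> R,
  [/\ interlaced n.+1 S F, zeros (POPUC n a lam) = points S &
    zeros (second_kind_POPUC n a lam) = points F].
Proof.
have := POPUC_dual a lam1; have := second_kind_dual a lam1.
rewrite size_tuple => -> ->; set b := dual lam a.
have b1 i : (i < n)%N -> `|b`_i| < 1.
  move=> ni; apply: (dual_lt1 lam1 (a := a)); last first.
    by rewrite mem_nth // size_dual size_tuple.
  by move=> _ /tnthP[j ->].
have [S [F [SF PS PF]]] := POPUC_interlaced b1 lam1.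
have [lS lF _] := SF.
(* The n + 1 distinct zeros found on the circle exhaust the degree, so there are no others. *)
have H mu G : arg_lift n.+1 G ->
    (forall t, root (POPUC n b mu) (expi t) <-> exists k, t = G k) ->
    zeros (POPUC n b mu) = points G.
  move=> lG PG; rewrite -(lift_range lG) //.
  rewrite -zeros_node_poly; congr zeros; apply: monic_node_poly.
  - exact: POPUC_monic.
  - exact: size_POPUC.
  - exact: lift_ord_inj.
  - by move=> j; apply/PG; exists j%:Z.
by exists S, F; split=> //; exact: H.
Qed.

Lemma zero_labelling_exists : exists w y : 'I_n.+1 -> R[i],
  zero_labelling a lam w y.
Proof.
have [S [F [SF PS PF]]] := POPUC_zeros.
have [lS lF _] := SF.
exists (fun j => expi (S j%:Z)), (fun j => expi (F j%:Z)); split.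
- by rewrite PS (lift_range lS) //; split=> //; exact: lift_clockwise.
- by rewrite PF (lift_range lF) //; split=> //; exact: lift_clockwise.
- by move=> k; exact: interlaced_first SF _.
Qed.

Lemma zero_labelling_interlace (w y : 'I_n.+1 -> R[i]) :
  zero_labelling a lam w y ->
  strictly_interlace w y /\ \prod_(j < n.+1) y j = - \prod_(j < n.+1) w j.
Proof.
move=> [[Pw /clockwise_ordered_inj wi] [Py /clockwise_ordered_inj yi] _].
split.
  have [S [F [SF PS PF]]] := POPUC_zeros.
  by apply: (interlaced_strictly _ SF) => //; rewrite -?PS -?PF.
(* The product of the zeros is read off at 0 and depends only on the parameter, which changes sign
   for the second kind. *)
have H mu c (v : 'I_n.+1 -> R[i]) : injective v ->
    zeros (POPUC n c mu) = range v ->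
    \prod_(j < n.+1) v j = (-1) ^+ n.+1 * - mu^*.
  move=> vi Pv; rewrite -(horner0_POPUC n c).
  rewrite (node_poly_unique (POPUC_monic n c mu) (size_POPUC n c mu) vi Pv).
  by rewrite horner0_node_poly mulrA -exprMn mulrNN mulr1 expr1n mul1r.
by rewrite (H _ _ _ wi Pw) (H _ _ _ yi Py) rmorphN /= mulrN.
Qed.

End Direct.

(** * From interlacing points to Verblunsky coefficients *)

Section Inverse.
Variable R : realType.
Implicit Types (s t u : R) (z lam : R[i]) (S F : int -> R) (m n : nat).

Lemma expi_surj_period z : `|z| = 1 -> exists2 t, 0 <= t < 2 * pi & z = expi t.
Proof.
move=> /expi_surj[t ->]; set k := Num.floor (t / (2 * pi)).
have p2 : 0 < 2 * pi :> R by rewrite mulr_gt0 // pi_gt0.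
have /andP[k1 k2] : k%:~R * (2 * pi) <= t < (k + 1)%:~R * (2 * pi).
  by rewrite -ler_pdivlMr // -ltr_pdivrMr // floor_itv.
exists (t - k%:~R * (2 * pi)).
  by rewrite intrD in k2; apply/andP; split; lra.
by rewrite -(expiD2pi (t - _) k) subrK.
Qed.

(** Arguments in [0, 2 pi[ are sorted downwards (their negatives upwards) and continued by full
    turns through Euclidean division of the index by m. *)
Lemma arg_lift_exists m (w : 'I_m -> R[i]) : (0 < m)%N -> injective w ->
  (forall j, `|w j| = 1) -> exists2 S, arg_lift m S & points S = range w.
Proof.
move=> m0 wi w1.
have [th thP] := choice (fun j => let: ex_intro2 t a b := expi_surj_period (w1 j) in
  ex_intro (fun t => 0 <= t < 2 * pi /\ w j = expi t) t (conj a b)).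
pose r := sort <=%O [seq - th j | j <- enum 'I_m].
have sr : size r = m by rewrite size_sort size_map size_enum_ord.
have mr k : (k < m)%N -> exists j, r`_k = - th j.
  move=> km; have : r`_k \in r by rewrite mem_nth ?sr.
  by rewrite {2}/r mem_sort => /mapP[j _ ->]; exists j.
have rlt : sorted <%O r.
  rewrite lt_sorted_uniq_le sort_le_sorted andbT sort_uniq map_inj_uniq ?enum_uniq //.
  by move=> i j /oppr_inj E; apply: wi; rewrite (thP i).2 E -(thP j).2.
have p2 : 0 < 2 * pi :> R by rewrite mulr_gt0 // pi_gt0.
pose S (i : int) := - r`_(`|(i %% m%:Z)%Z|%N) - (i %/ m%:Z)%Z%:~R * (2 * pi).
have SE (q : int) (k : nat) : (k < m)%N ->
    S (q * m%:Z + k%:Z) = - r`_k - q%:~R * (2 * pi).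
  move=> km; rewrite /S modzMDl divzMDl; last by lia.
  by rewrite modz_small ?divz_small ?addr0 //; lia.
have dec (i : int) : exists q (k : nat), (k < m)%N /\ i = q * m%:Z + k%:Z.
  exists (i %/ m%:Z)%Z, `|(i %% m%:Z)%Z|%N.
  have i0 : 0 <= (i %% m%:Z)%Z by rewrite modz_ge0 //; lia.
  by rewrite -ltz_nat gez0_abs // ltz_pmod // -divz_eq.
exists S.
  split=> i; have [q [k [km ->]]] := dec i; rewrite SE //.
    have [km'|km'] := ltnP k.+1 m.
      have -> : q * m%:Z + k%:Z + 1 = q * m%:Z + k.+1%:Z by lia.
      rewrite SE // ltrD2r ltrN2.
      by rewrite (lt_sorted_ltn_nth 0 rlt) ?inE ?sr.
    (* Passing to the next turn: two arguments in [0, 2 pi[ differ by less than the full turn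
       subtracted. *)
    have -> : q * m%:Z + k%:Z + 1 = (q + 1) * m%:Z + 0%:Z by lia.
    rewrite SE // intrD.
    have [i0 ->] := mr _ m0.
    have [i1 ->] := mr _ km.
    by have /andP[? ?] := (thP i0).1; have /andP[? ?] := (thP i1).1; lra.
  have -> : q * m%:Z + k%:Z + m%:Z = (q + 1) * m%:Z + k%:Z by lia.
  by rewrite SE // intrD; lra.
apply/seteqP; split=> _ [i _ <-].
  have [q [k [km ->]]] := dec i; rewrite SE //.
  have [j ->] := mr _ km.
  by exists j => //; rewrite opprK -mulNr -rmorphN /= expiD2pi (thP j).2.
have jr : - th i \in r by rewrite mem_sort; apply/mapP; exists i; rewrite ?mem_enum.
exists (0 * m%:Z + (index (- th i) r)%:Z) => //.
rewrite SE; last by rewrite -sr index_mem.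
by rewrite nth_index // opprK mul0r subr0 (thP i).2.
Qed.

(** F i is an argument of the unique y in the arc from S i to S (i + 1); uniqueness makes this
    choice compatible with full turns. *)
Lemma strictly_interlace_lift m (w y : 'I_m -> R[i]) : (0 < m)%N ->
  strictly_interlace w y -> exists S F,
    [/\ interlaced m S F, points S = range w & points F `<=` range y].
Proof.
move=> m0 [[wi yi] wy1 _ wy _].
have [S lS Sw] := arg_lift_exists m0 wi (fun j => (wy1 j).1).
have Si i : S (i + 1) < S i <= S (i + 1) + 2 * pi.
  by rewrite lS.1 -lerBlDr -lS.2 (lift_le lS); lia.
have Wi i : exists! z, range y z /\ clockwise_arc (expi (S i)) (expi (S (i + 1))) z.
  apply: wy; rewrite -?Sw; [by exists i|by exists (i + 1)|].
  apply/seteqP; split=> // z [/(arc_expi _ (Si i))[u + ->]] [k _ /esym uk].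
  have [l ->] := lift_args lS uk.
  by rewrite !(lift_lt lS); lia.
have Fi i : exists u, S (i + 1) < u < S i /\ range y (expi u).
  have [z [[yz /(arc_expi _ (Si i))[u ui zu]] _]] := Wi i.
  by exists u; rewrite -zu.
have [F FP] := choice Fi.
exists S, F; split=> // [|_ [i _ <-]]; last exact: (FP i).2.
split=> // [|i]; last exact: (FP i).1.
split=> i.
  have /andP[_ F1] := (FP (i + 1)).1; have /andP[F2 _] := (FP i).1.
  exact: lt_trans F1 F2.
have [z [_ zU]] := Wi i.
have [Fi1 yF] := FP i.
have [/andP[Fm1 Fm2] yFm] := FP (i + m%:Z).
rewrite addrAC !lS.2 in Fm1 Fm2.
have z1 : z = expi (F i).
  by apply: zU; split=> //; apply/(arc_expi _ (Si i)); exists (F i).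
have z2 : z = expi (F (i + m%:Z) + 1%:~R * (2 * pi)).
  apply: zU; split; first by rewrite expiD2pi.
  apply/(arc_expi _ (Si i)); exists (F (i + m%:Z) + 1%:~R * (2 * pi)) => //.
  by rewrite mul1r; apply/andP; split; lra.
suff : F i = F (i + m%:Z) + 1%:~R * (2 * pi) by rewrite mul1r => ->; rewrite addrK.
apply: expi_inj_near; last by rewrite -z1.
rewrite mul1r ltr_norml; have /andP[? ?] := Fi1; have /andP[? ?] := Si i.
by apply/andP; split; lra.
Qed.

(* The product condition fixes the sum of the [F j - S j] modulo [2 * pi], and
   interlacing confines it to [[- 2 * pi, 0]]. *)
Lemma interlaced_half_sum m S F : interlaced m S F ->
  \prod_(j < m) expi (F j%:Z) = - \prod_(j < m) expi (S j%:Z) ->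
  \sum_(j < m) (F j%:Z - S j%:Z) / 2 = - (pi / 2).
Proof.
move=> [lS lF SFS] FS.
have p0 := pi_gt0 R.
set X := \sum_(j < m) _.
have X0 : X <= 0.
  by apply: sumr_le0 => j _; have /andP[? ?] := SFS j%:Z; lra.
(* Each F j is above S (j + 1), and the resulting sum telescopes to half a turn. *)
have X1 : - pi <= X.
  have -> : - pi = \sum_(j < m) (S j.+1%:Z - S j%:Z) / 2.
    rewrite -mulr_suml -(big_mkord xpredT (fun j => S j.+1%:Z - S j%:Z)).
    by rewrite telescope_sumr // -[m%:Z]add0r lS.2; field.
  apply: ler_sum => j _; have /andP[+ _] := SFS j%:Z.
  have -> : j%:Z + 1 = j.+1%:Z by lia.
  by move=> ?; lra.
(* Both numbers lie in [- 2 pi, 0] at distance at most pi, so equal exponentials identify them. *)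
suff : 2 * X = - pi by move=> ?; lra.
apply: expi_inj_near; first by rewrite ltr_norml; apply/andP; split; lra.
rewrite /X -mulr_suml [2 * _]mulrC divfK ?pnatr_eq0 //
  sumrB expiD !expiN !expi_sum FS expi_pi.
by rewrite invrN1 mulNr divff // prodf_seq_neq0; apply/allP => j _; rewrite expi_neq0.
Qed.

(** In the quotient of two chord formulas the phase does not depend on a, so over all pairs (y_k,
    w_k) the phases add up to the half sum above. *)
Lemma chord_ratio (a b c : R) : sin ((a - c) / 2) != 0 ->
  expi a - expi b =
  (sin ((a - b) / 2) / sin ((a - c) / 2))%:C%C * expi ((b - c) / 2) *
    (expi a - expi c).
Proof.
move=> s0; rewrite !expiB rmorphM fmorphV /=.
have -> : (a + b) / 2 = (b - c) / 2 + (a + c) / 2 by field.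
have s0' : (sin ((a - c) / 2))%:C%C != 0 by rewrite (inj_eq (@complexI R)).
by rewrite expiD; field.
Qed.

(** The weight is the residue of Q / P at w_j divided by 2 w_j. The chord ratios split it into real
    factors, nonnegative by interlacing, and a phase that the product condition cancels. *)
Lemma interlaced_weights m S F (w := fun j : 'I_m => expi (S j%:Z))
    (y := fun j : 'I_m => expi (F j%:Z)) : interlaced m S F ->
  \prod_j y j = - \prod_j w j ->
  exists mu : 'I_m -> R[i], forall j, 0 <= mu j /\
    (node_poly y).[w j] = 2 * w j * mu j * \prod_(k < m | k != j) (w j - w k).
Proof.
move=> SF yw; have [lS lF SFS] := SF.
have p0 := pi_gt0 R.
pose rho (j k : 'I_m) : R :=
  sin ((S j%:Z - F k%:Z) / 2) / sin ((S j%:Z - S k%:Z) / 2).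
exists (fun j : 'I_m => (sin ((S j%:Z - F j%:Z) / 2) *
  \prod_(k < m | k != j) rho j k)%:C%C) => j.
have near (i k : 'I_m) : S i%:Z < S k%:Z + 2 * pi.
  by apply: (lift_lt2pi lS); have := ltn_ord i; have := ltn_ord k; lia.
have near1 (i k : 'I_m) : S i%:Z <= S (k%:Z + 1) + 2 * pi.
  rewrite -lerBlDr -lS.2 (lift_le lS).
  by have := ltn_ord i; have := ltn_ord k; lia.
have half_pos x : 0 < x < 2 * pi -> 0 < sin (x / 2).
  by move=> /andP[? ?]; apply: sin_gt0_pi; apply/andP; split; lra.
(* Seen from w_j, the points w_k and y_k are on the same side: both sines are positive for j < k and
   negative for k < j. *)
have rhoP k : k != j -> 0 <= rho j k /\ sin ((S j%:Z - S k%:Z) / 2) != 0.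
  move=> kj; have /andP[Fk1 Fk2] := SFS k%:Z.
  have := near j k; have := near k j; have := near1 j k => n1 n2 n3.
  have [jk|jk|/val_inj jk] := ltngtP (j : nat) k; last by rewrite jk eqxx in kj.
    have Sjk : S k%:Z < S j%:Z by rewrite (lift_lt lS).
    have h1 : 0 < sin ((S j%:Z - F k%:Z) / 2).
      by apply: half_pos; apply/andP; split; lra.
    have h2 : 0 < sin ((S j%:Z - S k%:Z) / 2).
      by apply: half_pos; apply/andP; split; lra.
    by rewrite lt0r_neq0 // divr_ge0 // ltW.
  have Skj : S j%:Z <= S (k%:Z + 1) by rewrite (lift_le lS); lia.
  have h1 : 0 < sin ((F k%:Z - S j%:Z) / 2).
    by apply: half_pos; apply/andP; split; lra.
  have h2 : 0 < sin ((S k%:Z - S j%:Z) / 2).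
    by apply: half_pos; apply/andP; split; lra.
  rewrite /rho -(opprB (F _)) -(opprB (S k%:Z)) !mulNr !sinN oppr_eq0.
  by rewrite lt0r_neq0 // invrN mulrNN divr_ge0 // ltW.
split.
  rewrite ler0c mulr_ge0 //.
    have /andP[F1 F2] := SFS j%:Z; have := near1 j j.
    by move=> ?; apply/ltW/half_pos/andP; split; lra.
  by apply: prodr_ge0 => k /rhoP[].
rewrite horner_prod (bigD1 j) //= hornerXsubC /y /w expiB.
have -> : \prod_(k < m | k != j) ('X - (expi (F k%:Z))%:P).[expi (S j%:Z)] =
    \prod_(k < m | k != j) (rho j k)%:C%C *
    \prod_(k < m | k != j) expi ((F k%:Z - S k%:Z) / 2) *
    \prod_(k < m | k != j) (expi (S j%:Z) - expi (S k%:Z)).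
  rewrite -!big_split; apply: eq_bigr => k /rhoP[_ sk] /=.
  by rewrite hornerXsubC (chord_ratio (F k%:Z) sk).
(* The phases, that of the chord w_j - y_j included, multiply to -i, which cancels the i of the
   chord formula. *)
have := interlaced_half_sum SF yw.
rewrite (bigD1 j) //= => /(congr1 (@expi R)).
rewrite expiD expi_sum.
have -> : (S j%:Z + F j%:Z) / 2 = S j%:Z + (F j%:Z - S j%:Z) / 2 by field.
rewrite expiD rmorphM rmorph_prod /=.
have -> : expi (- (pi / 2)) = - 'i%C :> R[i].
  by rewrite /expi cosN sinN cos_pihalf sin_pihalf; apply/eqP;
    rewrite eq_complex /= oppr0 !eqxx.
move: (\prod_(k | _) expi ((_ - _) / 2)) => E hE.
transitivity (2 * expi (S j%:Z) * (sin ((S j%:Z - F j%:Z) / 2))%:C%C *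
  (expi ((F j%:Z - S j%:Z) / 2) * E * 'i%C) * (\prod_(k < m | k != j) (rho j k)%:C%C) *
  \prod_(k < m | k != j) (expi (S j%:Z) - expi (S k%:Z))).
  by ring.
by rewrite hE mulNr -expr2 sqr_i opprK; ring.
Qed.

End Inverse.

(** * Coefficients from a pair of self-reciprocal polynomials *)

Section PairToVerblunsky.
Variable C : numClosedFieldType.
Implicit Types (b : seq C) (l : C) (n : nat).

Lemma POPUC_add_sub n b l : POPUC n b l + POPUC n b (- l) = 2 *: ('X * Phi b n).
Proof.
rewrite /POPUC rmorphN /= scaleNr opprK addrACA addNr addr0.
by rewrite scaler_nat mulr2n.
Qed.

(** With A = (P + Q) / (2 z), the reversal constants of P and Q are conj c and - conj c, so A^* =
    conj(c) (P - Q) / 2; half sum and half difference give back P and Q. *)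
Lemma POPUC_of_node_poly n (w y : 'I_n.+1 -> C) :
  (forall j, `|w j| = 1) -> (forall j, `|y j| = 1) ->
  \prod_j y j = - \prod_j w j -> disk_zeros (node_poly w + node_poly y) ->
  exists b l, [/\ size b = n, forall x, x \in b -> `|x| < 1, `|l| = 1,
    POPUC n b l = node_poly w & POPUC n b (- l) = node_poly y].
Proof.
move=> w1 y1 yw; set P := node_poly w; set Q := node_poly y => dPQ.
pose c := P.[0].
have Q0 : Q.[0] = - c by rewrite /c /P /Q !horner0_node_poly yw mulrN.
have c1 : `|c| = 1.
  rewrite /c horner0_node_poly normrM normrX normrN1 expr1n mul1r.
  by rewrite normr_prod big1.
have [A XA] : exists A, 'X * A = 2^-1 *: (P + Q).
  have : root (P + Q) 0 by rewrite rootE hornerD Q0 subrr.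
  move=> /factor_theorem[A]; rewrite subr0 => ->.
  by exists (2^-1 *: A); rewrite -scalerAr mulrC.
have two0 : 2 != 0 :> C by rewrite pnatr_eq0.
have Aco i : A`_i = 2^-1 * (P`_i.+1 + Q`_i.+1).
  by rewrite -coefD -coefZ -XA coefXM.
have An : A`_n = 1.
  rewrite Aco !(@monic_coef _ n.+1) ?node_poly_monic ?size_node_poly //.
  by rewrite -mulr2n mulVf.
have sA' : (size A <= n.+1)%N.
  apply/leq_sizeP => i ni.
  by rewrite Aco !nth_default ?size_node_poly // addr0 mulr0.
have sA : size A = n.+1.
  apply/eqP; rewrite eqn_leq sA' ltnNge; apply/negP => /leq_sizeP/(_ n (leqnn _)).
  by move/eqP; rewrite An oner_eq0.
have mA : A \is monic by rewrite monicE lead_coefE sA An.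
have dA : disk_zeros A.
  move=> z /dPQ; apply: contraNneq => Az.
  have := congr1 (horner^~ z) XA; rewrite hornerM Az mulr0 hornerZ => /esym/eqP.
  by rewrite mulf_eq0 invr_eq0 (negPf two0).
have [b [sb b1 PhiA]] := Phi_surj mA sA dA.
have rA : reversed n A = (2^-1 * c^*) *: (P - Q).
  rewrite -reversedXM XA reversedZ reversedD !reversed_node_poly //.
  rewrite -/P -/Q Q0 -/c rmorphN /= scaleNr -scalerBr scalerA.
  by rewrite fmorphV /= conjC_nat.
have cc : c * c^* = 1 by rewrite -normCK c1 expr1n.
have halves (U V : {poly C}) : 2^-1 *: (U + V) + 2^-1 *: (U - V) = U.
  by rewrite -scalerDr addrACA subrr addr0 -mulr2n -[U *+ 2]scaler_nat
    scalerA mulVf ?scale1r.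
(* A POPUC takes the value - conj(l) at 0, which must be c = P(0). *)
exists b, (- c^*); split=> //; first by rewrite normrN norm_conjC.
  rewrite /POPUC PhiA XA rA rmorphN /= conjCK scaleNr opprK scalerA mulrCA cc mulr1.
  exact: halves.
rewrite /POPUC PhiA XA rA opprK conjCK scalerA mulrCA cc mulr1 -scalerN opprB.
by rewrite [P + Q]addrC; exact: halves.
Qed.

End PairToVerblunsky.

(** * Existence and uniqueness for interlacing points *)

Section Converse.
Variables (R : realType) (n : nat) (w y : 'I_n.+1 -> R[i]).
Hypothesis wy : strictly_interlace w y.
Hypothesis yw : \prod_(j < n.+1) y j = - \prod_(j < n.+1) w j.

Let wi : injective w. Proof. by case: wy => -[]. Qed.
Let yi : injective y. Proof. by case: wy => -[]. Qed.
Let w1 j : `|w j| = 1. Proof. by case: wy => _ /(_ j)[]. Qed.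
Let y1 j : `|y j| = 1. Proof. by case: wy => _ /(_ j)[]. Qed.

(** Node polynomials forget the labelling, so w and y may be replaced by clockwise enumerations, for
    which the weights are available. *)
Lemma disk_zeros_interlace : disk_zeros (node_poly w + node_poly y).
Proof.
have [S [F [SF Sw Fy]]] := strictly_interlace_lift (ltn0Sn n) wy.
have [lS lF _] := SF.
(* An inclusion is enough: n + 1 distinct points of the range of [v] fill it. *)
have H (v : 'I_n.+1 -> R[i]) G : arg_lift n.+1 G ->
    points G `<=` range v ->
    node_poly v = node_poly (fun j : 'I_n.+1 => expi (G j%:Z)).
  move=> lG Gv; apply: monic_node_poly; rewrite ?node_poly_monic ?size_node_poly //.
    exact: lift_ord_inj.
  move=> j; suff : zeros (node_poly v) (expi (G j%:Z)) by [].
  by rewrite zeros_node_poly; apply: Gv; exists j%:Z.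
have Pw : node_poly w = node_poly (fun j : 'I_n.+1 => expi (S j%:Z)).
  by apply: H => //; rewrite Sw.
have Py : node_poly y = node_poly (fun j : 'I_n.+1 => expi (F j%:Z)) by exact: H.
have prodE (v u : 'I_n.+1 -> R[i]) : node_poly v = node_poly u ->
    \prod_j v j = \prod_j u j.
  move=> /(congr1 (horner^~ 0)); rewrite !horner0_node_poly.
  by apply: mulfI; rewrite signr_eq0.
have FS := yw; rewrite (prodE _ _ Pw) (prodE _ _ Py) in FS.
have [mu muP] := interlaced_weights SF FS.
rewrite Pw Py; apply: (disk_zeros_node_polyD (mu := mu)).
- exact: lift_ord_inj.
- by move=> j; rewrite norm_expi.
- move=> j k; apply/eqP => jk.
  suff : (points S `&` points F) (expi (S j%:Z)).
    by rewrite (interlaced_disjoint SF).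
  by split; [exists j%:Z|exists k%:Z].
- by move=> j; case: (muP j).
- by move=> j; case: (muP j).
- by rewrite hornerD !horner0_node_poly FS mulrN subrr.
Qed.

(** The coefficients [b] found for the pair are the dual ones, so [dual l b] is the answer. For
    uniqueness, the value at 0 fixes lambda, the sum of the two POPUCs fixes Phi_n of the dual
    sequence, and [Phi_inj] with [dualK] fixes the rest. *)
Lemma verblunsky_exists_unique : exists! p : n.-tuple R[i] * R[i],
  [/\ forall j, `|tnth p.1 j| < 1, `|p.2| = 1,
    zeros (POPUC n p.1 p.2) = range w &
    zeros (second_kind_POPUC n p.1 p.2) = range y].
Proof.
have [b [l [sb b1 l1 Pw Py]]] := POPUC_of_node_poly w1 y1 yw disk_zeros_interlace.
have sa : size (dual l b) = n by rewrite size_dual.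
pose a := tcast sa (in_tuple (dual l b)).
have aE : a = dual l b :> seq _ by rewrite val_tcast.
have POPUC_a : POPUC n (dual l b) l = POPUC n b l.
  by rewrite -[in LHS]sa POPUC_dual // dualK // sa.
have second_a : second_kind_POPUC n (dual l b) l = POPUC n b (- l).
  by rewrite -[in LHS]sa second_kind_dual // dualK // sa.
exists (a, l); split => /=.
  split=> //; rewrite ?aE.
  - move=> j; apply: (dual_lt1 l1 b1); rewrite -aE; exact: mem_tnth.
  - by rewrite POPUC_a Pw zeros_node_poly.
  - by rewrite second_a Py zeros_node_poly.
move=> [a' l'] /= [a'1 l'1 Pw' Py'].
have {}Pw' := node_poly_unique (POPUC_monic _ _ _) (size_POPUC _ _ _) wi Pw'.
have {}Py' := node_poly_unique (POPUC_monic _ _ _) (size_POPUC _ _ _) yi Py'.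
have ll : l' = l.
  have := congr1 (horner^~ 0) (etrans Pw' (esym Pw)).
  by rewrite !horner0_POPUC => /oppr_inj/(can_inj (@conjCK _)).
rewrite {}ll in Pw' Py' *; congr (_, _); apply/val_inj; rewrite /= aE.
have := POPUC_dual a' l1; have := second_kind_dual a' l1.
rewrite !size_tuple => second_a' POPUC_a'.
have PhiE : Phi b n = Phi (dual l a') n.
  apply: (mulfI (negbT (polyX_eq0 _))); apply: (@scalerI _ _ 2).
    by rewrite pnatr_eq0.
  by rewrite -!(POPUC_add_sub _ _ l) Pw Py -Pw' -Py' -POPUC_a' -second_a'.
have bE : b = dual l a'.
  apply: (@eq_from_nth _ 0); first by rewrite sb size_dual size_tuple.
  rewrite sb; apply: Phi_inj PhiE => i ib.
  by apply: b1; rewrite mem_nth // sb.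
by rewrite bE dualK.
Qed.

End Converse.

Theorem theorem9 (R : realType) (n : nat) (n_ge1 : (1 <= n)%N) :
  (forall (a : n.-tuple R[i]) (lam : R[i]),
     (forall j, `|tnth a j| < 1) -> `|lam| = 1 ->
     (exists w y : 'I_n.+1 -> R[i], zero_labelling a lam w y) /\
     (forall w y : 'I_n.+1 -> R[i], zero_labelling a lam w y ->
        strictly_interlace w y /\
        \prod_(j < n.+1) y j = - \prod_(j < n.+1) w j)) /\
  (forall w y : 'I_n.+1 -> R[i],
     strictly_interlace w y ->
     \prod_(j < n.+1) y j = - \prod_(j < n.+1) w j ->
     exists! p : n.-tuple R[i] * R[i],
       [/\ forall j, `|tnth p.1 j| < 1, `|p.2| = 1,
           zeros (POPUC n p.1 p.2) = range w &
           zeros (second_kind_POPUC n p.1 p.2) = range y]).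
Proof.
split=> [a lam a1 lam1|w y wy yw]; last exact: verblunsky_exists_unique.
split; first exact: zero_labelling_exists.
by move=> w y; exact: zero_labelling_interlace.
Qed.
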